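(* Let $k$ be a field of characteristic $0$ and let $u\in B$ be a basis monomial of $\mathrm{DerPerm}\langle X\rangle$ of weight $\mathrm{wt}(u)=-2$. Then $u^{*}\in ST\langle X\rangle$. In particular, $S\subseteq ST\langle X\rangle$, where $$S:=X\cup\{u^{*}\mid u\in B,\ \mathrm{wt}(u)=-2\}.$$
   Context: A perm algebra is an associative algebra satisfying $(ab)c=(ba)c$. $\mathrm{DerPerm}\langle X\rangle$ is the free differential perm algebra on $X=\{x_1,x_2,\dots\}$ over $k$: the free perm algebra generated by the symbols $x^{(s)}$ ($x\in X$, $s\ge0$, $x^{(0)}=x$) with derivation $d$ (written $a'=d(a)$) determined by $d(x^{(s)})=x^{(s+1)}$ and the Leibniz rule. $B$ is its standard basis, consisting of the monomials $x_{k_1}^{(i_1)}\cdots x_{k_{n-1}}^{(i_{n-1})}x_{k_n}^{(i_n)}$ with $n\ge1$, $k_1\le\dots\le k_{n-1}$, $k_n$ arbitrary, $i_j\ge 0$ (the first $n-1$ factors commute; monomials are identified when equal as elements). The weight of such a monomial is $\mathrm{wt}=\sum_{j=1}^n(i_j-1)$. The linear operator $*$ on $\mathrm{DerPerm}\langle X\rangle$ is defined recursively by $(x^{(i)})^{*}=x^{(i+1)}$ and $(uv)^{*}=u\,v^{*}+v\,u^{*}$. $ST\langle X\rangle$ is the smallest linear subspace of $\mathrm{DerPerm}\langle X\rangle$ containing $X$ and closed under the product $a\diamond b:=ab'+ba'$. *)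

(* Defs.v *)
From HB Require Import structures.
From mathcomp Require Import all_boot all_order all_algebra finmap multiset zify.
From mathcomp Require Import monalg.

Set Implicit Arguments.
Unset Strict Implicit.
Unset Printing Implicit Defensive.

Import GRing.Theory.
Local Open Scope mset_scope.
Local Open Scope ring_scope.

(* Locked: unfolding << m >> or the sum below makes failing unifications       *)
(* extremely slow.                                                             *)
HB.lock Definition basis (R : comNzRingType) (K : choiceType) (m : K) :
  {malg R[K]} := << m >>.
Arguments basis R {K} m.

HB.lock Definition linext (R : comNzRingType) (K : choiceType)
    (V : lmodType R) (f : K -> V) (g : {malg R[K]}) : V :=
  \sum_(m <- msupp g) g@_m *: f m.

Section LinearExtension.
Variables (R : comNzRingType) (K : choiceType) (V : lmodType R).
Implicit Types (f : K -> V) (g : {malg R[K]}).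

Lemma linextEw f (d : {fset K}) g : (msupp g `<=` d)%fset ->
  linext f g = \sum_(m <- d) g@_m *: f m.
Proof.
move=> le; rewrite linext.unlock (big_fset_incl _ le) // => m _ mg.
by rewrite mcoeff_outdom ?scale0r.
Qed.

Lemma linext_is_linear f : linear (linext f).
Proof.
move=> c g h; pose d := (msupp g `|` msupp h)%fset.
have lg : (msupp g `<=` d)%fset by apply: fsubsetUl.
have lh : (msupp h `<=` d)%fset by apply: fsubsetUr.
have lc : (msupp (c *: g + h) `<=` d)%fset.
  apply: fsubset_trans (msuppD_le _ _) _; apply: fsetSU; exact: msuppZ_le.
rewrite (linextEw _ lg) (linextEw _ lh) (linextEw _ lc) scaler_sumr -big_split.
by apply: eq_bigr => m _ /=; rewrite mcoeffD mcoeffZ scalerDl scalerA.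
Qed.

HB.instance Definition _ f :=
  GRing.isLinear.Build R {malg R[K]} V *:%R (linext f) (linext_is_linear f).

Lemma linextU f m : linext f (basis R m) = f m.
Proof.
by rewrite basis.unlock (linextEw _ msuppU_le) big_seq_fset1 mcoeffUU scale1r.
Qed.

Lemma linext_funP (F f g : K -> V) c u : (forall m, F m = c *: f m + g m) ->
  linext F u = c *: linext f u + linext g u.
Proof.
move=> E; rewrite !linext.unlock scaler_sumr -big_split; apply: eq_bigr => m _ /=.
by rewrite E scalerDr !scalerA mulrC.
Qed.

Lemma malg_ind (P : {malg R[K]} -> Prop) :
  P 0 -> (forall c m g, P g -> P (c *: basis R m + g)) -> forall g, P g.
Proof.
move=> P0 PD g; rewrite (monalgE g); elim/big_rec: _ => // m h _ Ph.
suff -> : << g@_m *g m >> = g@_m *: basis R m by exact: PD.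
by apply/malgP => m'; rewrite basis.unlock mcoeffZ !mcoeffU mulr_natr.
Qed.

Lemma linear_malg_eq (f g : {malg R[K]} -> V) : linear f -> linear g ->
  (forall m, f (basis R m) = g (basis R m)) -> f =1 g.
Proof.
move=> lf lg fg; have z (h : {malg R[K]} -> V) : linear h -> h 0 = 0.
  by move=> lh; have := lh (-1) 0 0; rewrite scaleN1r addr0 oppr0 scaleN1r addNr.
elim/malg_ind => [|c m u IH]; first by rewrite !z.
by rewrite lf lg fg IH.
Qed.
End LinearExtension.


(* The free perm algebra on Y: since all factors of a product but the last     *)
(* commute, a basis monomial is a pair (multiset of the factors y_1, ..,       *)
(* y_(n-1), last factor y_n).  See permA, permC and perm_free below.           *)
Definition pmon (Y : choiceType) : choiceType := ({mset Y} * Y)%type.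

Definition pmon_mul (Y : choiceType) (a b : pmon Y) : pmon Y :=
  (a.1 `+` (a.2 +` b.1), b.2).

Notation freePerm R Y := {malg R[pmon Y]}.

Section FreePerm.
Variables (R : comNzRingType) (Y : choiceType).
Implicit Types (u v w : freePerm R Y) (a b : pmon Y) (y : Y) (s : seq Y).

Definition pgen y : freePerm R Y := basis R ((mset0, y) : pmon Y).

Definition pmul u v : freePerm R Y :=
  linext (fun a => linext (fun b => basis R (pmon_mul a b)) v) u.

Definition pword s y : freePerm R Y := foldr (fun z => pmul (pgen z)) (pgen y) s.

Lemma pmulPl c u v w : pmul (c *: u + v) w = c *: pmul u w + pmul v w.
Proof. exact: linext_is_linear. Qed.

Lemma pmulPr c u v w : pmul u (c *: v + w) = c *: pmul u v + pmul u w.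
Proof. by apply: linext_funP => a; exact: linext_is_linear. Qed.

Lemma pmulDl u v w : pmul (u + v) w = pmul u w + pmul v w.
Proof. by have := pmulPl 1 u v w; rewrite !scale1r. Qed.

Lemma pmulDr u v w : pmul u (v + w) = pmul u v + pmul u w.
Proof. by have := pmulPr 1 u v w; rewrite !scale1r. Qed.

Lemma pmul0l u : pmul 0 u = 0.
Proof. by apply: (addrI (pmul 0 u)); rewrite -pmulDl !addr0. Qed.

Lemma pmul0r u : pmul u 0 = 0.
Proof. by apply: (addrI (pmul u 0)); rewrite -pmulDr !addr0. Qed.

Lemma pmulZl c u v : pmul (c *: u) v = c *: pmul u v.
Proof. by rewrite -[c *: u]addr0 pmulPl [pmul 0 v]pmul0l addr0. Qed.

Lemma pmulZr c u v : pmul u (c *: v) = c *: pmul u v.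
Proof. by rewrite -[c *: v]addr0 pmulPr [pmul u 0]pmul0r addr0. Qed.

Lemma pmul_suml (I : Type) (r : seq I) (F : I -> freePerm R Y) u :
  pmul (\sum_(i <- r) F i) u = \sum_(i <- r) pmul (F i) u.
Proof. exact: (big_morph (pmul^~ u) (fun v w => pmulDl v w u) (pmul0l u)). Qed.

Lemma pmul_sumr (I : Type) (r : seq I) (F : I -> freePerm R Y) u :
  pmul u (\sum_(i <- r) F i) = \sum_(i <- r) pmul u (F i).
Proof. exact: (big_morph (pmul u) (pmulDr u) (pmul0r u)). Qed.

Lemma pmulU a b : pmul (basis R a) (basis R b) = basis R (pmon_mul a b).
Proof. by rewrite /pmul !linextU. Qed.

Lemma pmul_ext2 (V : lmodType R) (F G : freePerm R Y -> freePerm R Y -> V) :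
  (forall v, linear (F^~ v)) -> (forall u, linear (F u)) ->
  (forall v, linear (G^~ v)) -> (forall u, linear (G u)) ->
  (forall a b, F (basis R a) (basis R b) = G (basis R a) (basis R b)) ->
  forall u v, F u v = G u v.
Proof.
move=> F1 F2 G1 G2 FG u v.
apply: (linear_malg_eq (F1 v) (G1 v)) => a.
by apply: (linear_malg_eq (F2 _) (G2 _)) => b; apply: FG.
Qed.

Lemma permA : associative pmul.
Proof.
move=> u v w; move: u v; apply: pmul_ext2.
- by move=> v c x y; rewrite pmulPl.
- by move=> u c x y; rewrite pmulPl pmulPr.
- by move=> v c x y; rewrite (pmulPl c x y v) (pmulPl c).
- by move=> u c x y; rewrite (pmulPr c _ x y) (pmulPl c).
move=> a b; pose F z : freePerm R Y := pmul (basis R a) (pmul (basis R b) z).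
apply: (@linear_malg_eq _ _ _ F (pmul (pmul (basis R a) (basis R b)))) => [c x y|c x y|c].
- by rewrite /F (pmulPr c _ x y) (pmulPr c).
- exact: pmulPr.
rewrite /F.
by rewrite !pmulU /pmon_mul /= !msetDA.
Qed.

Lemma permC u v w : pmul (pmul u v) w = pmul (pmul v u) w.
Proof.
move: u v; apply: pmul_ext2.
- by move=> v c x y; rewrite (pmulPl c x y v) (pmulPl c).
- by move=> u c x y; rewrite (pmulPr c _ x y) (pmulPl c).
- by move=> v c x y; rewrite (pmulPr c _ x y) (pmulPl c).
- by move=> u c x y; rewrite (pmulPl c x y u) (pmulPl c).
move=> a b; rewrite !pmulU.
apply: (@linear_malg_eq _ _ _ (pmul _) (pmul _)) => [c x y|c x y|c];
  try exact: pmulPr.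
rewrite !pmulU /pmon_mul /=; congr (basis R (_, _)).
by apply/msetP => y; rewrite !msetE2; lia.
Qed.

(* Every pair (p, y) is the product of the generators in p followed by y,      *)
(* whatever the order chosen for p.                                            *)
Lemma pwordE s y : pword s y = basis R ((seq_mset s, y) : pmon Y).
Proof.
elim: s => [|b s IH] /=.
  by congr (basis R (_, _)); apply/msetP => z; rewrite mset_seqE mset0E.
by rewrite IH pmulU /pmon_mul /= mset0D mset_cons.
Qed.

Lemma pword_enum (a : pmon Y) : pword (a.1 : {mset Y}) a.2 = (basis R a).
Proof. by rewrite pwordE seq_mset_id; case: a. Qed.

Section Universal.
Variables (V : lmodType R) (mu : V -> V -> V) (f : Y -> V).
Hypotheses (mul : forall v : V, linear (mu^~ v)) (mur : forall v : V, linear (mu v)).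
Hypotheses (muA : associative mu).
Hypothesis (muC : forall x y z : V, mu (mu x y) z = mu (mu y x) z).

Let F s (v : V) : V := foldr (fun y => mu (f y)) v s.

Let F_perm s t (v : V) : perm_eq s t -> F s v = F t v.
Proof.
elim: s t => [|b s IH] t; first by rewrite perm_sym => /perm_nilP ->.
move=> st; have bt : b \in t by rewrite -(perm_mem st) mem_head.
have -> : F t v = mu (f b) (F (rem b t) v).
  elim: t bt {st} => //= c t IHt; rewrite inE eq_sym; case: (c =P b) => [->//|cb].
  by move=> /= bt; rewrite IHt // !muA muC.
congr mu; apply: IH; rewrite -(perm_cons b).
by apply: perm_trans st _; apply: perm_to_rem.
Qed.

Theorem perm_free : exists h : freePerm R Y -> V,
  [/\ linear h, forall y, h (pgen y) = f y,
      forall u v, h (pmul u v) = mu (h u) (h v)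
    & forall h' : freePerm R Y -> V, linear h' ->
      (forall y, h' (pgen y) = f y) ->
      (forall u v, h' (pmul u v) = mu (h' u) (h' v)) -> h' =1 h].
Proof.
pose hm (a : pmon Y) := F (a.1 : {mset Y}) (f a.2).
have lh : linear (linext hm) by exact: linext_is_linear.
exists (linext hm); split=> //.
- by move=> y; rewrite linextU /hm /= enum_mset0.
- apply: pmul_ext2.
  + by move=> v c x y; rewrite pmulPl lh.
  + by move=> v c x y; rewrite pmulPr lh.
  + by move=> v c x y; rewrite lh mul.
  + by move=> v c x y; rewrite lh mur.
  move=> [p y] [q z]; rewrite pmulU !linextU /hm /=.
  have pE : perm_eq (msetD p (y +` q) : {mset Y})
      ((p : {mset Y}) ++ y :: (q : {mset Y})).
    apply/allP => x _ /=.
    by rewrite count_cat /= !count_mem_mset !msetE2 msetnE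
       [y == x]eq_sym; case: (x == y).
  rewrite (F_perm _ pE) /F foldr_cat /=.
  elim: (enum_mset (p : {mset Y})) => //= b t ->; exact: muA.
move=> h' lh' hg hM; apply: linear_malg_eq => // a.
rewrite linextU /hm -{1}(pword_enum a) /pword.
by elim: (enum_mset (a.1 : {mset Y})) => //= b t IH; rewrite hM hg IH.
Qed.
End Universal.
End FreePerm.

(* The letter (i, s) stands for the symbol x_i^(s). *)
Definition letter : choiceType := (nat * nat)%type.
Definition dletter (b : letter) : letter := (b.1, b.2.+1).

Notation derPerm R := (freePerm R letter).

Definition wt (m : pmon letter) : int :=
  \sum_(b <- (m.1 : {mset letter})) ((b.2)%:Z - 1) + ((m.2.2)%:Z - 1).

Lemma wt_word (s : seq letter) (a : letter) :
  wt (seq_mset s, a) = \sum_(b <- rcons s a) ((b.2)%:Z - 1).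
Proof.
rewrite /wt /= (perm_big _ (perm_eq_seq_mset s)).
by rewrite -cats1 big_cat big_seq1.
Qed.

Section DerPerm.
Variable R : comNzRingType.
Implicit Types (u v : derPerm R) (m : pmon letter) (a b : letter) (s : seq letter).

Definition var (i : nat) : derPerm R := pgen R ((i, 0%N) : letter).

(* Recursion on a product of letters, first letter first; the result does not  *)
(* depend on the enumeration of the multiset: see derM, starM and the          *)
(* uniqueness lemmas below.                                                    *)
Fixpoint der_word s a : derPerm R :=
  if s is b :: s' then
    pmul (pgen R (dletter b)) (pword R s' a) + pmul (pgen R b) (der_word s' a)
  else pgen R (dletter a).

Definition der : derPerm R -> derPerm R :=
  linext (fun m => der_word (m.1 : {mset letter}) m.2).

Fixpoint star_word s a : derPerm R :=
  if s is b :: s' then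
    pmul (pgen R b) (star_word s' a) + pmul (pword R s' a) (pgen R (dletter b))
  else pgen R (dletter a).

Definition star : derPerm R -> derPerm R :=
  linext (fun m => star_word (m.1 : {mset letter}) m.2).

HB.instance Definition _ := GRing.Linear.on der.
HB.instance Definition _ := GRing.Linear.on star.

(* The elements basis R m are exactly the monomials                            *)
(* x_(k_1)^(i_1) .. x_(k_(n-1))^(i_(n-1)) x_(k_n)^(i_n) with                   *)
(* k_1 <= .. <= k_(n-1).                                                       *)
Lemma basis_sorted m : exists s,
  [/\ sorted leq [seq b.1 | b <- s], basis R m = pword R s m.2
    & wt m = \sum_(b <- rcons s m.2) ((b.2)%:Z - 1)].
Proof.
pose s := sort (relpre fst leq) (m.1 : {mset letter}).
have sE : seq_mset s = m.1.
  rewrite -[RHS]seq_mset_id; apply/eq_seq_msetP; exact/permPl/perm_sort.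
exists s; split.
- by rewrite sorted_map; apply: sort_sorted => a b; apply: leq_total.
- by rewrite pwordE sE; case: m {s sE}.
- by rewrite -wt_word sE; case: m {s sE}.
Qed.

Let starm (P : {mset letter}) : derPerm R :=
  \sum_(b <- P) basis R ((P `\ b, dletter b) : pmon letter).

Let derm (P : {mset letter}) a : derPerm R :=
  \sum_(b <- P) basis R ((dletter b +` (P `\ b), a) : pmon letter)
  + basis R ((P, dletter a) : pmon letter).

Let word_perm (P : {mset letter}) a :
  perm_eq (a +` P) (a :: (P : {mset letter})).
Proof.
apply/allP => x _ /=.
by rewrite !count_mem_mset mset1DE [a == x]eq_sym.
Qed.

Let addP (P Q : {mset letter}) :
  perm_eq (P `+` Q) ((P : {mset letter}) ++ (Q : {mset letter})).
Proof.
by apply/allP => x _ /=; rewrite count_cat !count_mem_mset msetE2.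
Qed.

Let mset_DB1 (P Q : {mset letter}) a :
  a \in Q -> (P `+` Q) `\ a = P `+` (Q `\ a).
Proof. by move=> aQ; rewrite msetDBA ?msub1set. Qed.

Let mset_DBl (P Q : {mset letter}) a :
  a \in P -> (P `+` Q) `\ a = (P `\ a) `+` Q.
Proof. by move=> aP; rewrite msetDC mset_DB1 // msetDC. Qed.

Let mset_DDB1 (P P' Q : {mset letter}) a :
  a \in Q -> (P `+` (P' `+` Q)) `\ a = P `+` (P' `+` (Q `\ a)).
Proof. by move=> aQ; rewrite msetDA mset_DB1 // msetDA. Qed.

Let star_wordE s a : star_word s a = starm (seq_mset (a :: s)).
Proof.
have E (b : letter) : seq_mset [:: b] = [mset b].
  by apply/msetP => x; rewrite mset_seqE msetnE /= addn0 eq_sym; case: eqP.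
elim: s => [|b s IH] /=.
  rewrite /starm E enum_msetn big_seq1 /pgen; congr (basis R (_, _)).
  by apply/msetP => x; rewrite msetE2 mset0E subnn.
rewrite IH [RHS]/starm.
have pE : perm_eq (seq_mset [:: a, b & s]) (b :: seq_mset (a :: s)).
  apply: perm_trans (perm_eq_seq_mset _) _.
  rewrite (perm_catCA [:: a] [:: b] s) perm_cons perm_sym.
  exact: perm_eq_seq_mset.
have mE : seq_mset [:: a, b & s] = b +` seq_mset (a :: s).
  by rewrite !mset_cons msetDCA.
rewrite (perm_big _ pE) big_cons /= addrC mE msetD1K; congr (_ + _); last first.
  rewrite pwordE pmulU /pmon_mul /=; congr (basis R (_, _)).
  by rewrite msetD0 msetDC mset_cons.
rewrite /starm pmul_sumr big_seq [RHS]big_seq; apply: eq_bigr => c cP.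
rewrite pmulU /pmon_mul /= mset0D; congr (basis R (_, _)).
by rewrite mset_DB1.
Qed.

Let star_basis m : star (basis R m) = starm (m.2 +` m.1).
Proof. by rewrite /star linextU star_wordE mset_cons seq_mset_id. Qed.

Let der_wordE s a : der_word s a = derm (seq_mset s) a.
Proof.
elim: s => [|b s IH] /=.
  rewrite /derm [X in X + _]big1_seq ?add0r => [|b].
    by congr (basis R (_, _)); apply/msetP => z; rewrite mset_seqE mset0E.
  by rewrite in_mset mset_seqE.
have pE : perm_eq (seq_mset (b :: s)) (b :: seq_mset s).
  by rewrite mset_cons; apply: word_perm.
rewrite IH /derm (perm_big _ pE) big_cons /= mset_cons msetD1K -addrA.
congr (_ + _); first by rewrite pwordE pmulU /pmon_mul /= mset0D.
rewrite pmulDr pmul_sumr pmulU /pmon_mul /= mset0D; congr (_ + _).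
rewrite big_seq [RHS]big_seq; apply: eq_bigr => c cP.
rewrite pmulU /pmon_mul /= mset0D; congr (basis R (_, _)).
by rewrite mset_DB1 // msetDCA.
Qed.

Let der_basis m : der (basis R m) = derm m.1 m.2.
Proof. by rewrite /der linextU der_wordE seq_mset_id. Qed.

Lemma star_gen a : star (pgen R a) = pgen R (dletter a).
Proof. by rewrite /star linextU /= enum_mset0. Qed.

Lemma der_gen a : der (pgen R a) = pgen R (dletter a).
Proof. by rewrite /der linextU /= enum_mset0. Qed.

Lemma star_linear : linear star. Proof. exact: linext_is_linear. Qed.
Lemma der_linear : linear der. Proof. exact: linext_is_linear. Qed.

Lemma starM u v : star (pmul u v) = pmul u (star v) + pmul v (star u).
Proof.
move: u v; apply: pmul_ext2.
- by move=> v c x y; rewrite pmulPl star_linear.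
- by move=> u c x y; rewrite pmulPr star_linear.
- move=> v c x y; rewrite star_linear pmulPl pmulPr scalerDr.
  by rewrite addrACA.
- move=> u c x y; rewrite star_linear pmulPl pmulPr scalerDr.
  by rewrite addrACA.
move=> [p a] [q b]; rewrite pmulU !star_basis /pmon_mul /= /starm.
have qE : b +` (p `+` (a +` q)) = p `+` (a +` (b +` q)).
  by rewrite msetDCA [b +` (a +` q)]msetDCA.
have pE : b +` (p `+` (a +` q)) = q `+` (b +` (a +` p)).
  rewrite [p `+` (a +` q)]msetDCA [p `+` q]msetDC [a +` (q `+` p)]msetDCA.
  exact: msetDCA.
have bE : perm_eq (b +` (p `+` (a +` q)))
    ((b +` q : {mset letter}) ++ (a +` p : {mset letter})).
  rewrite pE msetDCA msetDA; exact: addP.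
rewrite (perm_big _ bE) big_cat /= !pmul_sumr; congr (_ + _).
  rewrite big_seq [RHS]big_seq; apply: eq_bigr => c cP.
  rewrite pmulU /pmon_mul /=; congr (basis R (_, _)).
  by rewrite qE mset_DDB1.
rewrite big_seq [RHS]big_seq; apply: eq_bigr => c cP.
rewrite pmulU /pmon_mul /=; congr (basis R (_, _)).
by rewrite pE mset_DDB1.
Qed.

Lemma derM u v : der (pmul u v) = pmul (der u) v + pmul u (der v).
Proof.
move: u v; apply: pmul_ext2.
- by move=> v c x y; rewrite pmulPl der_linear.
- by move=> u c x y; rewrite pmulPr der_linear.
- by move=> v c x y; rewrite der_linear !pmulPl scalerDr addrACA.
- by move=> u c x y; rewrite der_linear !pmulPr scalerDr addrACA.
move=> [p a] [q b]; rewrite pmulU !der_basis /pmon_mul /= /derm.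
have pE : perm_eq (p `+` (a +` q))
    ((p : {mset letter}) ++ a :: (q : {mset letter})).
  apply: perm_trans (addP _ _) _; rewrite perm_cat2l; exact: word_perm.
rewrite (perm_big _ pE) big_cat big_cons /= -!addrA.
rewrite pmulDl pmulDr pmul_suml pmul_sumr !pmulU /pmon_mul /= -!addrA.
congr (_ + _); last congr (_ + _); last congr (_ + _).
- rewrite big_seq [RHS]big_seq; apply: eq_bigr => c cP.
  rewrite pmulU /pmon_mul /=; congr (basis R (_, _)).
  by rewrite mset_DBl // msetDA.
- congr (basis R (_, _)).
  by rewrite [p `+` _]msetDCA msetD1K msetDCA.
rewrite big_seq [RHS]big_seq; apply: eq_bigr => c cP.
rewrite pmulU /pmon_mul /=; congr (basis R (_, _)).
by rewrite mset_DDB1 // msetDCA [dletter c +` _]msetDCA.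
Qed.

Lemma star_unique (h : derPerm R -> derPerm R) : linear h ->
  (forall a, h (pgen R a) = pgen R (dletter a)) ->
  (forall u v, h (pmul u v) = pmul u (h v) + pmul v (h u)) -> h =1 star.
Proof.
move=> lh hg hM; apply: linear_malg_eq => // [|m]; first exact: star_linear.
rewrite -pword_enum; elim: (enum_mset _) => [|b s IH] /=.
  by rewrite hg star_gen.
by rewrite hM starM IH hg star_gen.
Qed.

Lemma der_unique (h : derPerm R -> derPerm R) : linear h ->
  (forall a, h (pgen R a) = pgen R (dletter a)) ->
  (forall u v, h (pmul u v) = pmul (h u) v + pmul u (h v)) -> h =1 der.
Proof.
move=> lh hg hM; apply: linear_malg_eq => // [|m]; first exact: der_linear.
rewrite -pword_enum; elim: (enum_mset _) => [|b s IH] /=.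
  by rewrite hg der_gen.
by rewrite hM derM IH hg der_gen.
Qed.

Definition diamond u v : derPerm R := pmul u (der v) + pmul v (der u).

Inductive ST : derPerm R -> Prop :=
| ST_var i : ST (var i)
| ST_zero : ST 0
| ST_add u v : ST u -> ST v -> ST (u + v)
| ST_scale (c : R) u : ST u -> ST (c *: u)
| ST_diamond u v : ST u -> ST v -> ST (diamond u v).

Definition S_set u : Prop :=
  (exists i, u = var i) \/
  (exists m : pmon letter, wt m = -2 /\ u = star (basis R m)).
End DerPerm.

(* Main.v *)
(* Let D be the derivation induced on the commutative monomials, and let T(f)  *)
(* be the common value of u^* for all u with underlying commutative monomial   *)
(* f.  Since * commutes with the derivation and u^* w = u' w, one has          *)
(*   x <> T(g) = T(x Dg)  and  T(f) <> T(g) = T(Df Dg)                         *)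
(* for a variable x.  So, by induction on the length, in weight -2 and modulo  *)
(* ker(T mod ST), both x Dg and (x y)' Dg vanish for x, y in X.  The first     *)
(* relation (integration by parts) gives x y' h = x' y h, hence the second     *)
(* one gives 2 x y' Dg = 0; as x D(y' g) = 0 this yields x y'' g = 0, and      *)
(* integrating by parts again kills x y^(i) h for all i >= 2.  Only the        *)
(* monomials x y z_1' ... z_r' remain; expanding x D(y z_1 z_2' ... z_r') = 0  *)
(* gives twice such a monomial, up to terms with a second derivative.          *)
Require Import Defs.
From HB Require Import structures.
From mathcomp Require Import all_boot all_order all_algebra finmap multiset.
From mathcomp Require Import monalg zify.

Set Implicit Arguments.
Unset Strict Implicit.
Unset Printing Implicit Defensive.

Import GRing.Theory.
Local Open Scope ring_scope.

(** The operator [star] sees only the underlying commutative monomial ([star_letters_perm]) and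
    turns [diamond] into the product of derivatives ([diamond_star], [diamond_var_star]). Products
    of elements known to be in [ST] thus become linear relations modulo [ST] among stars of longer
    monomials of weight -2, and an induction on length solves these relations ([ST_order_n]).
    [ST_by_parts] moves a derivative off one factor onto the others and [ST_swap] moves a first
    derivative between two factors; with [ST_var2_leibniz] they dispose of every monomial having a
    factor of order at least 2 ([ST_high_der]). The remaining monomials, with two factors of order 0
    and the rest of order 1, reduce to that case. *)

Section Closure.
Variable R : comNzRingType.
Implicit Types u v : derPerm R.

Lemma ST_opp u : ST u -> ST (- u).
Proof. by move=> Su; rewrite -scaleN1r; apply: ST_scale. Qed.

Lemma ST_sub u v : ST u -> ST v -> ST (u - v).
Proof. by move=> Su Sv; apply: ST_add => //; apply: ST_opp. Qed.

Lemma ST_addKr u v : ST u -> ST (u + v) -> ST v.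
Proof. by move=> Su Suv; rewrite -[v](addKr u); apply/ST_add/Suv/ST_opp. Qed.

Lemma ST_addKl u v : ST v -> ST (u + v) -> ST u.
Proof. by rewrite addrC; apply: ST_addKr. Qed.

Lemma ST_sum (I : eqType) (r : seq I) (F : I -> derPerm R) :
  (forall i, i \in r -> ST (F i)) -> ST (\sum_(i <- r) F i).
Proof.
move=> SF; rewrite big_seq; apply: big_rec => [|i u ri Su]; first exact: ST_zero.
by apply/ST_add/Su/SF.
Qed.
End Closure.

(** * The operator [star] and the derivation *)

Section Star.
Variable R : comNzRingType.
Implicit Types (u v w : derPerm R) (s t g h : seq letter) (a b c : letter).

Lemma pmulCA u v w : pmul u (pmul v w) = pmul v (pmul u w).
Proof. by rewrite !permA permC. Qed.

Lemma pword_perm s t a : perm_eq s t -> pword R s a = pword R t a.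
Proof. by move=> /eq_seq_msetP st; rewrite !pwordE st. Qed.

Lemma pmul_pword s a w :
  pmul (pword R s a) w = foldr (fun b => pmul (pgen R b)) w (rcons s a).
Proof. by elim: s => //= b s IH; rewrite -permA IH. Qed.

Lemma pmul_pwordC s a b w :
  pmul (pword R (b :: s) a) w = pmul (pword R (a :: s) b) w.
Proof.
rewrite !pmul_pword /= -!cats1 !foldr_cat /=.
elim: s => /= [|c s IH]; first by rewrite pmulCA.
by rewrite pmulCA IH pmulCA.
Qed.

Lemma pmul_pword_cat s a t b :
  pmul (pword R s a) (pword R t b) = pword R (s ++ a :: t) b.
Proof. by elim: s => //= c s IH; rewrite -permA IH. Qed.

Lemma derPerm_word_ind (P : derPerm R -> Prop) :
  P 0 -> (forall (r : R) u v, P u -> P v -> P (r *: u + v)) ->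
  (forall a, P (pgen R a)) -> (forall a u, P u -> P (pmul (pgen R a) u)) ->
  forall u, P u.
Proof.
move=> P0 PD Pg PM; elim/malg_ind => // c m u Pu; apply: PD => //.
by rewrite -pword_enum; elim: (enum_mset _) => //= b s IH; apply: PM.
Qed.

Lemma star_der u : star (der u) = der (star u).
Proof.
elim/derPerm_word_ind: u => [|c u v IHu IHv|a|a u IH]; rewrite ?linear0 //.
- by rewrite !linearP /= IHu IHv.
- by rewrite der_gen !star_gen der_gen.
rewrite derM starM linearD /= !starM linearD /= !derM IH der_gen !star_gen der_gen.
by rewrite addrACA; congr (_ + _); rewrite addrC.
Qed.

(** To the left of [w] all letters commute, so it does not matter that [star] moves the
    differentiated letter to the end while [der] leaves it in place. *)
Lemma pmul_star u w : pmul (star u) w = pmul (der u) w.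
Proof.
elim/derPerm_word_ind: u => [|c u v IHu IHv|a|a u IH]; rewrite ?linear0 //.
- by rewrite !linearP /= !pmulPl IHu IHv.
- by rewrite der_gen star_gen.
rewrite derM starM !pmulDl der_gen star_gen addrC; congr (_ + _).
  by rewrite permC.
by rewrite -!permA IH.
Qed.

(** By [pmul_star] and [star_der] the left side is [u' (v')^* + v' (u')^*], which is the product
    rule of [star] for [u' v']. *)
Lemma diamond_star u v :
  diamond (star u) (star v) = star (pmul (der u) (der v)).
Proof. by rewrite /diamond !pmul_star -!star_der starM. Qed.

Lemma diamond_var_star i v :
  diamond (var R i) (star v) = star (pmul (var R i) (der v)).
Proof. by rewrite /diamond pmul_star -star_der starM star_gen der_gen. Qed.

(** * Stars of commutative monomials *)

(** The head of the list is the last factor of the monomial, the one that does not commute. *)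
Definition word s : derPerm R := if s is a :: s' then pword R s' a else 0.

Definition star_letters s : derPerm R := star (word s).

(** Since [star] puts the differentiated letter last, the last letter of the monomial loses its
    special role. Only its exchange with another letter ([swap]) needs checking; the others commute
    already. *)
Lemma star_letters_perm s t : perm_eq s t -> star_letters s = star_letters t.
Proof.
have swap r a b : star_letters [:: a, b & r] = star_letters [:: b, a & r].
  rewrite /star_letters; elim: r => [|c r IH].
    by rewrite /= !starM !star_gen addrC.
  have E d e : word [:: d, e, c & r] = pmul (pgen R c) (word [:: d, e & r]).
    by rewrite /= pmulCA.
  by rewrite !E [LHS]starM [RHS]starM IH star_gen /= pmul_pwordC.
case: s t => [|a s] [|b t] //.
- by move/perm_size.
- by move/perm_size.
have [->|ab] := eqVneq a b.
  by rewrite perm_cons => st; rewrite /star_letters /= (pword_perm _ st).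
move=> st; have bs : b \in s.
  by have := mem_head b t; rewrite -(perm_mem st) inE eq_sym (negPf ab).
have sE := perm_to_rem bs.
have tE : perm_eq t (a :: rem b s).
  rewrite -(perm_cons b) perm_sym (perm_catCA [:: b] [:: a]) /=.
  by apply: perm_trans st; rewrite perm_cons perm_sym.
rewrite [LHS]/star_letters [RHS]/star_letters /=.
by rewrite (pword_perm _ sE) (pword_perm _ tE); apply: swap.
Qed.

Lemma star_pmul_word s t : s != [::] -> t != [::] ->
  star (pmul (word s) (word t)) = star_letters (s ++ t).
Proof.
case: s t => [|a s] [|b t] // _ _; rewrite /= pmul_pword_cat.
apply: (@star_letters_perm (b :: _) (_ :: _)).
rewrite -(cat1s b) (perm_catCA [:: b] s) perm_sym.
by rewrite -(cat1s a) (perm_catCA [:: a] s) perm_cat2l /= (perm_catCA [:: a] [:: b]).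
Qed.

Fixpoint leibniz s : seq (seq letter) :=
  if s is b :: s' then (dletter b :: s') :: map (cons b) (leibniz s') else [::].

Lemma der_word_leibniz s : der (word s) = \sum_(t <- leibniz s) word t.
Proof.
case: s => [|a s] /=; first by rewrite linear0 big_nil.
rewrite big_cons big_map /=; elim: s => [|b s IH] /=.
  by rewrite der_gen big_nil addr0.
rewrite derM der_gen IH big_cons big_map pmulDr pmul_sumr /=.
by rewrite addrCA.
Qed.

Definition ord_sum s := sumn [seq b.2 | b <- s].

Lemma ord_size_cons x i s :
  (ord_sum ((x, i) :: s) = i + ord_sum s)%N * (size ((x, i) :: s) = (size s).+1).
Proof. by []. Qed.

Lemma perm_stat s t : perm_eq s t -> size s = size t /\ ord_sum s = ord_sum t.
Proof. by move=> st; split; [apply: perm_size|apply/perm_sumn/perm_map]. Qed.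

Lemma leibniz_stat s t : t \in leibniz s ->
  size t = size s /\ ord_sum t = (ord_sum s).+1.
Proof.
elim: s t => //= b s IH t; rewrite inE => /predU1P[->//|/mapP[r /IH [rs ro] ->]].
by rewrite /ord_sum /= -!/(ord_sum _) rs ro addnS.
Qed.

Lemma star_pmul_leibniz s t : s != [::] ->
  star (pmul (word s) (der (word t))) =
  \sum_(t' <- leibniz t) star_letters (s ++ t').
Proof.
move=> s0; rewrite der_word_leibniz pmul_sumr linear_sum /=.
rewrite big_seq [RHS]big_seq; apply: eq_bigr => t' tt'.
rewrite star_pmul_word //; have [] := leibniz_stat tt'.
by case: t tt' => // ? ? _; case: t'.
Qed.
End Star.

(** * Relations modulo [ST] in length [n] *)

Section Reduction.
Variables (k : fieldType) (n : nat).
Hypothesis two_neq0 : 2%:R != 0 :> k.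
Implicit Types (s t g h : seq letter) (x y z i : nat).
Local Notation T := (star_letters k).

(* [ord_sum s + 2 = size s] says that the weight is -2. *)
Hypothesis ST_smaller : forall s,
  (ord_sum s + 2 = size s)%N -> (size s < n)%N -> ST (T s).

Lemma ST_halve (u : derPerm k) : ST (u + u) -> ST u.
Proof.
move=> Su; suff -> : u = 2%:R^-1 *: (u + u) by exact: ST_scale.
by rewrite -mulr2n -scaler_nat scalerA mulVf // scale1r.
Qed.

Lemma ST_var_leibniz x g : (ord_sum g + 2 = size g)%N -> (size g < n)%N ->
  ST (\sum_(g' <- leibniz g) T ((x, 0%N) :: g')).
Proof.
move=> g2 gn; rewrite -(star_pmul_leibniz k (s := [:: (x, 0%N)])) //.
by rewrite -diamond_var_star; apply: ST_diamond; [exact: ST_var|exact: ST_smaller].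
Qed.

(** This is the expansion of [x D(y^(i) h)]. *)
Lemma ST_by_parts x y i h : (ord_sum h + i + 1 = size h)%N -> (size h + 2 = n)%N ->
  ST (T [:: (x, 0%N), (y, i.+1) & h] +
      \sum_(h' <- leibniz h) T [:: (x, 0%N), (y, i) & h']).
Proof.
move=> hi hn; have := @ST_var_leibniz x ((y, i) :: h).
rewrite !ord_size_cons /leibniz -/leibniz big_cons big_map.
by apply; lia.
Qed.

(** The two sums expand [(x y)' Dg], which comes from the [diamond] of the stars of [x y] and [g];
    [2 < n] makes [x y] a shorter monomial. *)
Lemma ST_var2_leibniz x y g :
  (ord_sum g + 2 = size g)%N -> (size g < n)%N -> (2 < n)%N ->
  ST (\sum_(g' <- leibniz g) T [:: (x, 1%N), (y, 0%N) & g'] +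
      \sum_(g' <- leibniz g) T [:: (x, 0%N), (y, 1%N) & g']).
Proof.
move=> g2 gn n2.
rewrite -(star_pmul_leibniz k (s := [:: (x, 1%N); (y, 0%N)])) //.
rewrite -(star_pmul_leibniz k (s := [:: (x, 0%N); (y, 1%N)])) //.
have -> : forall u v : derPerm k, star u + star v = star (u + v).
  by move=> u v; rewrite linearD.
rewrite -pmulDl.
have -> : word k [:: (x, 1%N); (y, 0%N)] + word k [:: (x, 0%N); (y, 1%N)] =
    der (word k [:: (x, 0%N); (y, 0%N)]).
  by rewrite der_word_leibniz /= !big_cons big_nil addr0.
by rewrite -diamond_star; apply: ST_diamond; apply: ST_smaller.
Qed.

Lemma star_letters_swap2 a b s : T [:: a, b & s] = T [:: b, a & s].
Proof. by apply: star_letters_perm; rewrite (perm_catCA [:: a] [:: b]). Qed.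

(** Integrating [x D(y h)] and [y D(x h)] by parts leaves the same remainder [x y Dh], which cancels
    in the difference. *)
Lemma ST_swap x y h : (ord_sum h + 1 = size h)%N -> (size h + 2 = n)%N ->
  ST (T [:: (x, 0%N), (y, 1%N) & h] - T [:: (x, 1%N), (y, 0%N) & h]).
Proof.
move=> h1 hn.
have Sx a b : ST (T [:: (a, 0%N), (b, 1%N) & h] +
    \sum_(h' <- leibniz h) T [:: (a, 0%N), (b, 0%N) & h']).
  by apply: ST_by_parts; lia.
have := ST_sub (Sx x y) (Sx y x).
under [X in _ - (_ + X)]eq_bigr do rewrite star_letters_swap2.
by rewrite opprD addrACA subrr addr0 (star_letters_swap2 (y, _)).
Qed.

Lemma ST_snd_der x y g : (ord_sum g + 2 = size g)%N -> (size g + 2 = n)%N ->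
  ST (T [:: (x, 0%N), (y, 2) & g]).
Proof.
(* [U] stands for [x y' Dg] and [V] for [x' y Dg]: both [U - V] and [U + V] are in [ST], hence so is
   [2 U]. *)
move=> g2 gn; pose U := \sum_(g' <- leibniz g) T [:: (x, 0%N), (y, 1%N) & g'].
have SU : ST U.
  apply: ST_halve; pose V := \sum_(g' <- leibniz g) T [:: (x, 1%N), (y, 0%N) & g'].
  have SUV : ST (U - V).
    rewrite -sumrB; apply: ST_sum => g' /leibniz_stat[g's g'o].
    by apply: ST_swap; lia.
  have SVU : ST (V + U) by apply: ST_var2_leibniz; lia.
  by rewrite -[X in X + _](subrK V) -addrA; apply: ST_add.
by apply: (ST_addKl SU); apply: ST_by_parts; lia.
Qed.

(** Integration by parts trades [y^(i+3) h] for [y^(i+2) Dh], so the induction on [i] must let [h]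
    vary. *)
Lemma ST_high_der x y i h : (ord_sum h + i.+2 = size h)%N -> (size h + 2 = n)%N ->
  ST (T [:: (x, 0%N), (y, i.+2) & h]).
Proof.
elim: i h => [|i IH] h hi hn; first exact: ST_snd_der.
apply: ST_addKl (@ST_by_parts x y i.+2 h _ hn); last by rewrite -hi; lia.
by apply: ST_sum => h' /leibniz_stat[h's h'o]; apply: IH; lia.
Qed.

Lemma has_order0 s : (ord_sum s < size s)%N ->
  exists x t, perm_eq s ((x, 0%N) :: t).
Proof.
move=> lt_s; have /hasP[[x i] xs /eqP /= i0] : has (fun b => b.2 == 0%N) s.
  apply: contraLR lt_s; rewrite -all_predC -leqNgt.
  elim: s => [|[x i] s IH] // /andP[i0 /IH]; rewrite !ord_size_cons.
  have : i != 0%N by []; lia.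
by exists x, (rem (x, i) s); rewrite -i0 perm_to_rem.
Qed.

Lemma ST_has_order2 s : (ord_sum s + 2 = size s)%N -> size s = n ->
  has (fun b => 1 < b.2)%N s -> ST (T s).
Proof.
move=> s2 sn /hasP[[y [|[|i]]] ys //= _].
have sE := perm_to_rem ys; set r := rem _ s in sE.
have [] := perm_stat sE; rewrite !ord_size_cons => sr so.
(* Without the letter of order at least 2, the total order is still below the length, which provides
   an [x] of order 0. *)
have [|x [t rE]] := @has_order0 r; first lia.
have [] := perm_stat rE; rewrite !ord_size_cons => tr to.
have /star_letters_perm -> : perm_eq s [:: (x, 0%N), (y, i.+2) & t].
  apply: perm_trans sE _; rewrite perm_sym.
  by rewrite (perm_catCA [:: (x, 0%N)] [:: (y, i.+2)]) perm_cons perm_sym.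
by apply: ST_high_der; lia.
Qed.

Lemma leibniz_order2 s t : all (fun b => b.2 == 1%N) s -> t \in leibniz s ->
  has (fun b => 1 < b.2)%N t.
Proof.
elim: s t => //= b s IH t /andP[/eqP b1 s1]; rewrite inE => /predU1P[->|].
  by rewrite /= b1.
by move=> /mapP[r /(IH _ s1) r2 ->] /=; rewrite r2 orbT.
Qed.

Lemma ord_sum_le_size s : all (predC (fun b => 1 < b.2)%N) s ->
  (ord_sum s <= size s)%N.
Proof.
elim: s => [|[z i] s IH] // /andP[i1 /IH]; rewrite !ord_size_cons.
have : ~~ (1 < i)%N by []. lia.
Qed.

Lemma all_order1 s : all (predC (fun b => 1 < b.2)%N) s -> ord_sum s = size s ->
  all (fun b => b.2 == 1%N) s.
Proof.
elim: s => [|[z i] s IH] // /andP[i1 s1]; have {}i1 : ~~ (1 < i)%N by [].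
rewrite !ord_size_cons => os; have le_s := ord_sum_le_size s1.
have -> : i = 1%N by lia.
by rewrite /= IH //; lia.
Qed.

Lemma ST_order_n s : (ord_sum s + 2 = size s)%N -> size s = n -> ST (T s).
Proof.
move=> s2 sn; have [|] := boolP (has (fun b => 1 < b.2)%N s).
  exact: ST_has_order2.
rewrite -all_predC => s1.
have [|x [r sE]] := @has_order0 s; first lia.
have [] := perm_stat sE; rewrite !ord_size_cons => sr so.
have [|y [t rE]] := @has_order0 r; first lia.
have [] := perm_stat rE; rewrite !ord_size_cons => tr to.
have stE : perm_eq s [:: (x, 0%N), (y, 0%N) & t].
  by apply: perm_trans sE _; rewrite perm_cons.
move: s1; rewrite (perm_all _ stE) (star_letters_perm _ stE) /= => t1.
have {}t1 : all (fun b => b.2 == 1%N) t.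
  by apply: all_order1 => //; lia.
case: t t1 {rE stE} tr to => [|[z i] h].
  move=> _ _ _; have -> : T [:: (x, 0%N); (y, 0%N)] = diamond (var k y) (var k x).
    by rewrite /diamond /star_letters /= starM !star_gen !der_gen.
  by apply: ST_diamond; apply: ST_var.
rewrite !ord_size_cons => /andP[/eqP i1 h1] tr to.
have {}i1 : i = 1%N := i1; rewrite {}i1 in to *.
(* With [w] the star of [x z y' h], [ST_swap] gives [u - w], and integration by parts gives [u + w]
   up to terms [x z y Dh]. As all letters of [h] have order 1, these terms contain a second
   derivative. Adding yields [2 u]. *)
apply: ST_halve; set u := star_letters _ _.
have SD : ST (u + \sum_(h' <- leibniz ((y, 0%N) :: h)) T [:: (x, 0%N), (z, 0%N) & h']).
  have -> : u = T [:: (x, 0%N), (z, 1%N), (y, 0%N) & h].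
    by apply: star_letters_perm; rewrite perm_cons (perm_catCA [:: _] [:: _]).
  by apply: ST_by_parts; rewrite !ord_size_cons; lia.
have Sswap : ST (u - T [:: (x, 0%N), (z, 0%N), (y, 1%N) & h]).
  have rot a b c : T [:: a, b, c & h] = T [:: b, c, a & h].
    by apply: star_letters_perm; rewrite (perm_catCA [:: a] [:: b; c] h).
  rewrite /u !(rot (x, 0%N)) (star_letters_swap2 (z, 0%N)).
  by apply: ST_swap; rewrite !ord_size_cons; lia.
move: SD; rewrite /leibniz -/leibniz big_cons big_map addrA => SD.
rewrite -{2}[u](subrK (T [:: (x, 0%N), (z, 0%N), (y, 1%N) & h])) addrCA.
apply: ST_add => //; apply: ST_addKl SD.
apply: ST_sum => h' hh'; have [h's h'o] := leibniz_stat hh'.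
apply: ST_has_order2; rewrite ?ord_size_cons; try lia.
by rewrite /= (leibniz_order2 h1 hh').
Qed.
End Reduction.

(** * Induction on length and translation of the weight *)

Lemma ST_star_letters (k : fieldType) s : 2%:R != 0 :> k ->
  (ord_sum s + 2 = size s)%N -> ST (star_letters k s).
Proof.
move=> k2; have [n] := ubnP (size s); elim: n s => // n IH s lt_sn s2.
by apply: (@ST_order_n k (size s)) => // t t2 lt_ts; apply: IH => //; lia.
Qed.

Lemma sum_wt (s : seq letter) :
  \sum_(b <- s) ((b.2)%:Z - 1) = (ord_sum s)%:Z - (size s)%:Z.
Proof.
elim: s => [|[x i] s IH]; first by rewrite big_nil.
by rewrite big_cons !ord_size_cons IH -[(x, i).2]/i; lia.
Qed.

Lemma wt_ord_sum (m : pmon letter) (s := (m.2 :: enum_mset m.1) : seq letter) :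
  wt m = (ord_sum s)%:Z - (size s)%:Z.
Proof. by rewrite -sum_wt /s big_cons addrC. Qed.

Theorem theorem4p5 (k : fieldType) (k_char0 : [pchar k] =i pred0) :
  (forall m : pmon letter, wt m = -2 -> ST (star (basis k m))) /\
  (forall v : derPerm k, S_set v -> ST v).
Proof.
have k2 : 2%:R != 0 :> k by have /pcharf0P -> := k_char0.
have Sstar (m : pmon letter) : wt m = -2 -> ST (star (basis k m)).
  rewrite wt_ord_sum -pword_enum => wm.
  by apply: (@ST_star_letters k (_ :: _)) => //; lia.
by split=> // v [[i ->]|[m [wm ->]]]; [apply: ST_var|apply: Sstar].
Qed.
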